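(* For every $\mathbf{K}\in\mathcal{K}$, $$\big\langle \nabla^{\star}\mathcal{J}(\mathbf{K}),\,\mathbf{K}-\mathbf{K}^\star \big\rangle = \big(\mathcal{J}(\mathbf{K})-\mathcal{J}^\star\big) + Q_H(\mathbf{K}).$$
   Context: Setting. $\{\rho_1,\dots,\rho_S\}$ is a finite grid with weights $\nu_s>0$, $\sum_{s=1}^S\nu_s=1$. $w_1,\dots,w_N$ are continuous weighting functions with $w_i(\rho)\ge 0$ and $\sum_{i=1}^N w_i(\rho)=1$; $A(\rho)=\sum_i w_i(\rho)A_i$ and $B(\rho)=\sum_i w_i(\rho)B_i$ with $A_i\in\mathbb{R}^{n\times n}$, $B_i\in\mathbb{R}^{n\times m}$. The matrices $Q,\Sigma_0\in\mathbb{R}^{n\times n}$ and $R\in\mathbb{R}^{m\times m}$ are symmetric positive definite. A gain $K\in\mathbb{R}^{m\times n}$ stabilizes plant $s$ if $A_{\mathrm{cl}}=A(\rho_s)-B(\rho_s)K$ is Schur stable (spectral radius $<1$). For such $K$: $P$ is the solution of $P=A_{\mathrm{cl}}^\top P A_{\mathrm{cl}}+Q+K^\top RK$; $\Sigma$ is the solution of $\Sigma=A_{\mathrm{cl}}\Sigma A_{\mathrm{cl}}^\top+\Sigma_0$; $J_s(K)=\operatorname{tr}(P\Sigma_0)$; $H=R+B(\rho_s)^\top PB(\rho_s)$; $E=HK-B(\rho_s)^\top PA(\rho_s)$. A schedule is a tuple $\mathbf{K}=(K_1,\dots,K_N)$ of matrices in $\mathbb{R}^{m\times n}$; its deployed gain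 at grid point $s$ is $K_{\mathbf{K}}(\rho_s)=\sum_i w_i(\rho_s)K_i$. The feasible set is $\mathcal{K}=\{\mathbf{K}: K_{\mathbf{K}}(\rho_s)\text{ stabilizes plant } s,\ s=1,\dots,S\}$, and the scheduled cost is $\mathcal{J}(\mathbf{K})=\sum_s\nu_s J_s(K_{\mathbf{K}}(\rho_s))$ on $\mathcal{K}$. Write $P_s,\Sigma_s,E_s,H_s$ for the matrices $P,\Sigma,E,H$ of plant $s$ at the deployed gain $K=K_{\mathbf{K}}(\rho_s)$. Standing assumptions: $\mathcal{K}\ne\emptyset$ and $G_w=\sum_s\nu_s w(\rho_s)w(\rho_s)^\top\succ0$, where $w(\rho)=(w_1(\rho),\dots,w_N(\rho))^\top$. Under these, $\mathcal{J}$ attains its minimum over $\mathcal{K}$; $\mathbf{K}^\star\in\mathcal{K}$ denotes a fixed minimizer, $\mathcal{J}^\star=\mathcal{J}(\mathbf{K}^\star)$, and $\Sigma_s^\star$ is the covariance $\Sigma$ of plant $s$ at the gain $K_{\mathbf{K}^\star}(\rho_s)$. The inner product is $\langle X,Y\rangle=\operatorname{tr}(X^\top Y)$, summed over the tuple. The starred gradient $\nabla^{\star}\mathcal{J}(\mathbf{K})$ is the tuple with blocks $\nabla^{\star}_{K_i}\mathcal{J}(\mathbf{K})=2\sum_s\nu_s w_i(\rho_s)E_s\Sigma_s^\star$, $i=1,\dots,N$ (with $E_s$ evaluated at $\mathbf{K}$). With $\Delta_s=K_{\mathbf{K}}(\rho_s)-K_{\mathbf{K}^\star}(\rho_s)$,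 $Q_H(\mathbf{K})=\sum_s\nu_s\operatorname{tr}(\Sigma_s^\star\Delta_s^\top H_s\Delta_s)$. *)

(* Defs.v *)
From mathcomp Require Import all_boot all_order all_algebra.
From mathcomp Require Import all_classical all_reals topology normedtype.
From mathcomp Require Import complex.

Set Implicit Arguments.
Unset Strict Implicit.
Unset Printing Implicit Defensive.

Import Order.TTheory GRing.Theory Num.Theory.
Import numFieldNormedType.Exports.

Local Open Scope classical_set_scope.
Local Open Scope ring_scope.

Section Matrices.
Context {R : realType}.

Definition posdef n (M : 'M[R]_n) : Prop :=
  M^T = M /\ forall x : 'cV[R]_n, x != 0 -> 0 < (x^T *m M *m x) 0 0.

(* The supremum of a finite set, hence a maximum (and 0 when n = 0). *)
Definition spectral_radius n (M : 'M[R]_n) : R :=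
  sup [set r | exists2 z : R[i],
    eigenvalue (map_mx (real_complex R) M) z & r = ComplexField.Normc.normc z].

Definition schur_stable n (M : 'M[R]_n) : Prop := spectral_radius M < 1.

End Matrices.

(* One plant (A, B) with cost matrices Q, Rm, initial covariance Sigma0 and
   gain K. *)
Section Plant.
Context {R : realType} {n m : nat}.
Variables (A : 'M[R]_n) (B : 'M[R]_(n, m)).
Variables (Q : 'M[R]_n) (Rm : 'M[R]_m) (Sigma0 : 'M[R]_n).
Variable K : 'M[R]_(m, n).

Definition closed_loop : 'M[R]_n := A - B *m K.

Definition stabilizes : Prop := schur_stable closed_loop.

(* Each of the next two equations has exactly one solution when K stabilizes
   (A, B), and [xget] then selects it; the value is only meaningful there. *)
Definition value_mx : 'M[R]_n :=
  xget 0 [set P | P = closed_loop^T *m P *m closed_loop + Q + K^T *m Rm *m K].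

Definition covariance_mx : 'M[R]_n :=
  xget 0 [set Sg | Sg = closed_loop *m Sg *m closed_loop^T + Sigma0].

Definition lqr_cost : R := \tr (value_mx *m Sigma0).

Definition H_mx : 'M[R]_m := Rm + B^T *m value_mx *m B.

Definition E_mx : 'M[R]_(m, n) := H_mx *m K - B^T *m value_mx *m A.

End Plant.

(* T is the space of scheduling parameters, N the number of vertices,
   S the number of grid points. *)
Record sched_lqr (R : realType) (T : topologicalType) (n m N S : nat) :=
  SchedLQR {
    grid : 'I_S -> T;
    nu : 'I_S -> R;
    wt : 'I_N -> T -> R;
    vertexA : 'I_N -> 'M[R]_n;
    vertexB : 'I_N -> 'M[R]_(n, m);
    costQ : 'M[R]_n;
    costR : 'M[R]_m;
    cov0 : 'M[R]_n }.

Definition tuple_dot (R : realType) (m n N : nat)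
    (X Y : 'I_N -> 'M[R]_(m, n)) : R :=
  \sum_(i < N) \tr ((X i)^T *m Y i).

Section Schedule.
Context {R : realType} {T : topologicalType} {n m N S : nat}.
Variable D : sched_lqr R T n m N S.

Definition plantA (p : T) : 'M[R]_n := \sum_(i < N) wt D i p *: vertexA D i.

Definition plantB (p : T) : 'M[R]_(n, m) :=
  \sum_(i < N) wt D i p *: vertexB D i.

Definition weight_col (p : T) : 'cV[R]_N := \col_(i < N) wt D i p.

Definition weight_gram : 'M[R]_N :=
  \sum_(s < S) nu D s *: (weight_col (grid D s) *m (weight_col (grid D s))^T).

Definition schedule := 'I_N -> 'M[R]_(m, n).

Definition deployed (K : schedule) (p : T) : 'M[R]_(m, n) :=
  \sum_(i < N) wt D i p *: K i.

Definition feasible (K : schedule) : Prop :=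
  forall s : 'I_S,
    stabilizes (plantA (grid D s)) (plantB (grid D s)) (deployed K (grid D s)).

Definition plant_cost (s : 'I_S) (L : 'M[R]_(m, n)) : R :=
  lqr_cost (plantA (grid D s)) (plantB (grid D s))
    (costQ D) (costR D) (cov0 D) L.

Definition sched_cost (K : schedule) : R :=
  \sum_(s < S) nu D s * plant_cost s (deployed K (grid D s)).

Definition is_minimizer (K : schedule) : Prop :=
  feasible K /\ forall K', feasible K' -> sched_cost K <= sched_cost K'.

Definition sched_cov (K : schedule) (s : 'I_S) : 'M[R]_n :=
  covariance_mx (plantA (grid D s)) (plantB (grid D s)) (cov0 D)
    (deployed K (grid D s)).

Definition sched_H (K : schedule) (s : 'I_S) : 'M[R]_m :=
  H_mx (plantA (grid D s)) (plantB (grid D s)) (costQ D) (costR D)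
    (deployed K (grid D s)).

Definition sched_E (K : schedule) (s : 'I_S) : 'M[R]_(m, n) :=
  E_mx (plantA (grid D s)) (plantB (grid D s)) (costQ D) (costR D)
    (deployed K (grid D s)).

Definition starred_gradient (Kstar K : schedule) : schedule :=
  fun i => 2 *: \sum_(s < S)
    (nu D s * wt D i (grid D s)) *: (sched_E K s *m sched_cov Kstar s).

Definition gain_gap (Kstar K : schedule) (s : 'I_S) : 'M[R]_(m, n) :=
  deployed K (grid D s) - deployed Kstar (grid D s).

Definition QH (Kstar K : schedule) : R :=
  \sum_(s < S) nu D s *
    \tr (sched_cov Kstar s *m (gain_gap Kstar K s)^T *m sched_H K s
         *m gain_gap Kstar K s).

End Schedule.

(* Main.v *)
(* Write A', K', P', Sigma' for the closed loop, gain, value and covariance of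
   the starred schedule at one grid point, and D for the gain gap.  Expanding
   the Lyapunov equation of P around the starred gain gives
     P - A'^T P A' = Q + K'^T R K' + D^T E + E^T D - D^T H D.
   Pairing with Sigma' turns the left-hand side into J(K) and the first two
   terms on the right into J(K'), by the Lyapunov equations of Sigma' and P';
   the weighted sum over the grid is the claim.  The values selected by [xget]
   solve their equations because X |-> X - M X M^T is injective, hence onto,
   when the spectrum of M lies in the open unit disc. *)
Require Import Defs.
From HB Require Import structures.
From mathcomp Require Import all_boot all_order all_algebra.
From mathcomp Require Import all_classical all_reals topology normedtype.
From mathcomp Require Import complex ring.

Set Implicit Arguments.
Unset Strict Implicit.
Unset Printing Implicit Defensive.

Import Order.TTheory GRing.Theory Num.Theory.
Import numFieldNormedType.Exports.
Local Open Scope classical_set_scope.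
Local Open Scope ring_scope.

Lemma eigenvalue_trmx (F : fieldType) (n : nat) (M : 'M[F]_n) :
  eigenvalue M^T =1 eigenvalue M.
Proof.
move=> a; rewrite !eigenvalue_root_char; congr (root _ a).
by rewrite /char_poly -[RHS]det_tr /char_poly_mx linearB /= tr_scalar_mx
  map_trmx.
Qed.

(* From X = M X L, each (M - z) X solves the same equation, so the factors of
   the characteristic polynomial of M can be cancelled from char_poly(M) X = 0
   one at a time: (M - z) X = 0 gives X = z X L, so a nonzero row of X would
   make 1/z an eigenvalue of L. *)
Lemma stein_kernel (C : numClosedFieldType) (n p : nat)
    (M : 'M[C]_n) (L : 'M[C]_p) (X : 'M[C]_(n, p)) :
    (forall z, eigenvalue M z -> `|z| < 1) ->
    (forall z, eigenvalue L z -> `|z| < 1) ->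
  X = M *m X *m L -> X = 0.
Proof.
case: n M X => [|n] M X ltM ltL XE; first exact: flatmx0.
have [r char_r] := closed_field_poly_normal (char_poly M).
rewrite (monicP (char_poly_monic M)) scale1r in char_r.
have lt_r z : z \in r -> `|z| < 1.
  move=> zr; apply: ltM; rewrite eigenvalue_root_char char_r.
  by rewrite root_prod_XsubC.
have : horner_mx M (\prod_(z <- r) ('X - z%:P)) *m X = 0.
  by rewrite -char_r Cayley_Hamilton mul0mx.
elim: r {char_r} lt_r X XE => [|z r IHr] lt_r X XE.
  by rewrite big_nil rmorph1 mul1mx.
rewrite big_cons mulrC rmorphM /= -mulmxA => prX0.
have MzX0 : horner_mx M ('X - z%:P) *m X = 0.
  apply: IHr prX0 => [t tr|]; first by rewrite lt_r // inE tr orbT.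
  rewrite {1}XE !mulmxA; congr (_ *m _ *m _).
  by rewrite rmorphB /= horner_mx_X horner_mx_C mulmxBl mulmxBr scalar_mxC.
have {MzX0} MX : M *m X = z *: X.
  move: MzX0; rewrite rmorphB /= horner_mx_X horner_mx_C mulmxBl mul_scalar_mx.
  by move/subr0_eq.
have ltz1 : `|z| < 1 by rewrite lt_r // mem_head.
have {XE} XL : X = z *: (X *m L) by rewrite {1}XE MX scalemxAl.
apply/row_matrixP => i; rewrite row0; apply/eqP/negPn/negP => Xi0.
have XLi : row i X = z *: (row i X *m L).
  by rewrite {1}XL linearZ /= row_mul.
have z0 : z != 0 by apply: contraNneq Xi0 => z0; rewrite XLi z0 scale0r.
have : `|z^-1| < 1.
  apply: ltL; apply/eigenvalueP; exists (row i X) => //.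
  by rewrite {2}XLi scalerA mulVf // scale1r.
by rewrite normfV invf_lt1 ?normr_gt0 // => /(lt_trans ltz1); rewrite ltxx.
Qed.

Lemma schur_stable_eigenvalue (R : realType) (n : nat) (M : 'M[R]_n) :
    schur_stable M ->
  forall z, eigenvalue (map_mx (real_complex R) M) z -> `|z| < 1.
Proof.
move=> stM z Mz.
have [r char_r] :=
  closed_field_poly_normal (char_poly (map_mx (real_complex R) M)).
rewrite (monicP (char_poly_monic _)) scale1r in char_r.
rewrite -[`|z|]/((ComplexField.Normc.normc z)%:C)%C ltcR.
apply: le_lt_trans stM; apply: ub_le_sup; last by exists z.
(* [sup] dominates the members of a set only once it is bounded above; the sum of the moduli of all
   roots of the characteristic polynomial is such a bound. *)
exists (\sum_(t <- r) ComplexField.Normc.normc t) => _ [t Mt ->].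
move: Mt; rewrite eigenvalue_root_char char_r root_prod_XsubC => tr.
rewrite (big_rem t tr) /= lerDl sumr_ge0 // => u _.
by case: u => a b; rewrite /ComplexField.Normc.normc sqrtr_ge0.
Qed.

Section SteinEquation.
Context {R : realType} {n : nat}.
Variable M : 'M[R]_n.

Lemma schur_stable_trmx : schur_stable M -> schur_stable M^T.
Proof.
rewrite /schur_stable /spectral_radius -map_trmx.
set MC := map_mx _ M.
by have -> : eigenvalue MC^T = eigenvalue MC by apply/funext/eigenvalue_trmx.
Qed.

Hypothesis M_stable : schur_stable M.

(** The difference of two solutions solves the homogeneous equation; [stein_kernel] makes its
    complexification vanish, as [M] and [M^T] share their spectrum. *)
Lemma stein_unique (C X Y : 'M[R]_n) :
  X = M *m X *m M^T + C -> Y = M *m Y *m M^T + C -> X = Y.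
Proof.
move=> XE YE; apply: subr0_eq; apply: (map_mx_inj (f := real_complex R)).
rewrite map_mx0.
apply: (stein_kernel (schur_stable_eigenvalue M_stable)
          (schur_stable_eigenvalue (schur_stable_trmx M_stable))).
rewrite -!map_mxM; congr map_mx.
by rewrite mulmxBr mulmxBl {1}XE {1}YE opprD addrACA subrr addr0.
Qed.

Lemma stein_solvable (C : 'M[R]_n) : exists X, X = M *m X *m M^T + C.
Proof.
pose f (X : 'M[R]_n) := X - M *m X *m M^T.
have f_lin : linear f.
  move=> a X Y; rewrite /f mulmxDr mulmxDl -scalemxAr -scalemxAl.
  by rewrite scalerBr opprD addrACA.
pose F : {linear 'M[R]_n -> 'M[R]_n} :=
  HB.pack f (GRing.isLinear.Build _ _ _ _ f f_lin).
have F_unit : lin_mx F \in unitmx.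
  rewrite -row_free_unit -kermx_eq0; apply/rowV0P => v /sub_kermxP.
  rewrite mul_rV_lin => /(canRL mxvecK); rewrite linear0 => FX0.
  apply: (can_inj vec_mxK); rewrite linear0.
  (* A matrix in the kernel of [F] and the zero matrix both solve the equation with [C = 0]. *)
  apply: (@stein_unique 0); rewrite ?mulmx0 ?mul0mx addr0 //.
  exact: subr0_eq.
exists (vec_mx (mxvec C *m invmx (lin_mx F))).
apply/eqP; rewrite addrC -subr_eq; apply/eqP; rewrite -[LHS]/(F _).
by apply: (can_inj mxvecK); rewrite -mul_rV_lin mulmxKV.
Qed.

(** The transpose solves the same equation, so uniqueness applies. *)
Lemma stein_sym (C X : 'M[R]_n) :
  C^T = C -> X = M *m X *m M^T + C -> X^T = X.
Proof.
move=> CT XE; apply: (@stein_unique C) => //.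
by rewrite {1}XE linearD /= !trmx_mul trmxK CT mulmxA.
Qed.

End SteinEquation.

Section Plant.
Context {R : realType} {n m : nat}.
Variables (A : 'M[R]_n) (B : 'M[R]_(n, m)).
Variables (Q : 'M[R]_n) (Rm : 'M[R]_m) (Sigma0 : 'M[R]_n).
Variable K : 'M[R]_(m, n).
Hypothesis K_stab : stabilizes A B K.

Let M := closed_loop A B K.
Let P := value_mx A B Q Rm K.
Let Sg := covariance_mx A B Sigma0 K.

Lemma value_mxE : P = M^T *m P *m M + Q + K^T *m Rm *m K.
Proof.
(* [xget] falls back on its default 0 only when no solution exists, which [stein_solvable] for [M^T]
   excludes. *)
rewrite /P /value_mx; case: xgetP => [X -> //|noX]; exfalso.
have [X XE] := stein_solvable (schur_stable_trmx K_stab) (Q + K^T *m Rm *m K).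
by apply: (noX X); rewrite /= -addrA {1}XE trmxK.
Qed.

Lemma covariance_mxE : Sg = M *m Sg *m M^T + Sigma0.
Proof.
rewrite /Sg /covariance_mx; case: xgetP => [X -> //|noX]; exfalso.
by have [X XE] := stein_solvable K_stab Sigma0; apply: (noX X).
Qed.

Lemma value_mx_sym : Q^T = Q -> Rm^T = Rm -> P^T = P.
Proof.
move=> QT RT; apply:
  (stein_sym (schur_stable_trmx K_stab) (C := Q + K^T *m Rm *m K)).
  by rewrite linearD /= !trmx_mul trmxK QT RT mulmxA.
by rewrite trmxK addrA; apply: value_mxE.
Qed.

Lemma covariance_mx_sym : Sigma0^T = Sigma0 -> Sg^T = Sg.
Proof. by move=> ST; apply: (stein_sym K_stab ST); apply: covariance_mxE. Qed.

(** Under the trace pairing, [X - M^T X M] is adjoint to [Y - M Y M^T], whose value at [Y = Sg] is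
    [Sigma0]. *)
Lemma trace_cov0 (X : 'M[R]_n) :
  \tr (X *m Sigma0) = \tr ((X - M^T *m X *m M) *m Sg).
Proof.
have -> : Sigma0 = Sg - M *m Sg *m M^T by rewrite {1}covariance_mxE addrC addKr.
move: (M) (Sg) => L Y; rewrite mulmxBr mulmxBl !raddfB; congr (_ - _).
by rewrite /= !mulmxA mxtrace_mulC !mulmxA.
Qed.

Lemma lqr_costE_covariance :
  lqr_cost A B Q Rm Sigma0 K = \tr ((Q + K^T *m Rm *m K) *m Sg).
Proof.
rewrite /lqr_cost trace_cov0; congr (\tr (_ *m _)).
by rewrite -/P {1}value_mxE -[X in X - _]addrA addrC addrK.
Qed.

End Plant.

Lemma starred_value_gap (R : comPzRingType) (n m : nat)
    (A : 'M[R]_n) (B : 'M[R]_(n, m)) (Q : 'M[R]_n) (Rm : 'M[R]_m)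
    (P : 'M[R]_n) (K Ks : 'M[R]_(m, n)) :
    P^T = P -> Rm^T = Rm ->
    P = (A - B *m K)^T *m P *m (A - B *m K) + Q + K^T *m Rm *m K ->
  let H := Rm + B^T *m P *m B in
  let E := H *m K - B^T *m P *m A in
  P - (A - B *m Ks)^T *m P *m (A - B *m Ks)
    = Q + Ks^T *m Rm *m Ks
      + ((K - Ks)^T *m E + E^T *m (K - Ks) - (K - Ks)^T *m H *m (K - Ks)).
Proof.
move=> PT RT PE H E.
pose M := A - B *m K; pose d := K - Ks.
have EE : E = Rm *m K - B^T *m P *m M.
  by rewrite /E /H /M mulmxDl mulmxBr opprB addrA !mulmxA.
have ET : E^T = K^T *m Rm - M^T *m P *m B.
  by rewrite EE linearB /= !trmx_mul trmxK PT RT mulmxA.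
have KsE : Ks = K - d by rewrite /d subKr.
have MsE : A - B *m Ks = M + B *m d.
  by rewrite KsE mulmxBr opprB addrCA addrC /M addrC.
rewrite -/M in PE; clearbody M d; rewrite MsE ET EE /H KsE subKr {1}PE.
rewrite !linearD !linearN /= !trmx_mul.
rewrite !(mulmxDl, mulmxDr, mulNmx, mulmxN, mulmxA).
(* Only additive cancellation between identical matrix products is left; entrywise it takes place in
   a commutative ring, where [ring] applies. *)
apply/matrixP => i j.
have Dij (X Y : 'M[R]_n) : (X + Y) i j = X i j + Y i j by rewrite mxE.
have Nij (X : 'M[R]_n) : (- X) i j = - X i j by rewrite mxE.
by rewrite !(Dij, Nij); ring.
Qed.

Lemma lqr_cost_gap (R : realType) (n m : nat)
    (A : 'M[R]_n) (B : 'M[R]_(n, m)) (Q : 'M[R]_n) (Rm : 'M[R]_m)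
    (Sigma0 : 'M[R]_n) (K Ks : 'M[R]_(m, n))
    (H := H_mx A B Q Rm K) (E := E_mx A B Q Rm K)
    (Sg := covariance_mx A B Sigma0 Ks) :
    Q^T = Q -> Rm^T = Rm -> Sigma0^T = Sigma0 ->
    stabilizes A B K -> stabilizes A B Ks ->
  2 * \tr ((E *m Sg)^T *m (K - Ks))
    = lqr_cost A B Q Rm Sigma0 K - lqr_cost A B Q Rm Sigma0 Ks
      + \tr (Sg *m (K - Ks)^T *m H *m (K - Ks)).
Proof.
move=> QT RT ST K_stab Ks_stab.
have SgT : Sg^T = Sg by apply: covariance_mx_sym.
have PT := value_mx_sym K_stab QT RT.
have PE := value_mxE Q Rm K_stab.
rewrite (lqr_costE_covariance Q Rm Sigma0 Ks_stab).
(* The cost of [K] is evaluated against the covariance of [Ks]: [trace_cov0] allows any [X], here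
   the value matrix of [K]. *)
rewrite /lqr_cost (trace_cov0 Sigma0 Ks_stab).
rewrite /closed_loop (starred_value_gap Ks PT RT PE) -/(H_mx A B Q Rm K).
rewrite -/(E_mx A B Q Rm K) -/H -/E -/Sg.
rewrite -raddfB -mulmxBl /= [X in \tr (X *m Sg)]addrAC subrr add0r.
set d := K - Ks; clearbody d E H; rewrite mulmxBl mulmxDl raddfB raddfD /=.
rewrite [\tr (d^T *m H *m d *m Sg)]mxtrace_mulC !mulmxA subrK.
(* Since [Sg] is symmetric, the two cross terms have equal traces; this is the factor 2. *)
rewrite -[\tr (d^T *m E *m Sg)]mxtrace_tr !trmx_mul trmxK SgT mulmxA.
by rewrite [\tr (E^T *m d *m Sg)]mxtrace_mulC mulmxA mulr2n mulrDl mul1r.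
Qed.

Theorem lemma1 (R : realType) (T : topologicalType) (n m N S : nat)
  (D : sched_lqr R T n m N S)
  (nu_gt0 : forall s : 'I_S, 0 < nu D s)
  (nu_sum1 : \sum_(s < S) nu D s = 1)
  (wt_continuous : forall i : 'I_N, continuous (wt D i))
  (wt_ge0 : forall (i : 'I_N) (p : T), 0 <= wt D i p)
  (wt_sum1 : forall p : T, \sum_(i < N) wt D i p = 1)
  (costQ_posdef : posdef (costQ D))
  (costR_posdef : posdef (costR D))
  (cov0_posdef : posdef (cov0 D))
  (feasible_nonempty : exists K : 'I_N -> 'M[R]_(m, n), feasible D K)
  (gram_posdef : posdef (weight_gram D))
  (Kstar : 'I_N -> 'M[R]_(m, n))
  (Kstar_min : is_minimizer D Kstar)
  (K : 'I_N -> 'M[R]_(m, n))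
  (K_feasible : feasible D K) :
  tuple_dot (starred_gradient D Kstar K) (fun i => K i - Kstar i)
  = (sched_cost D K - sched_cost D Kstar) + QH D Kstar K.
Proof.
have [Kstar_feasible _] := Kstar_min.
have gapE s : gain_gap D Kstar K s
    = \sum_(i < N) wt D i (grid D s) *: (K i - Kstar i).
  rewrite /gain_gap /deployed -sumrB.
  by apply: eq_bigr => i _; rewrite scalerBr.
rewrite /sched_cost /QH -sumrB -big_split /=.
(* Deployment is linear in the tuple, so exchanging the sums over vertices and grid points turns the
   block pairings into one pairing with the gain gap per grid point. *)
transitivity (\sum_(s < S) nu D s *
    (2 * \tr ((sched_E D K s *m sched_cov D Kstar s)^T
             *m gain_gap D Kstar K s))).
  rewrite /tuple_dot /starred_gradient.
  under eq_bigr => i _.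
    rewrite linearZ linear_sum /= -scalemxAl mulmx_suml linearZ linear_sum /=.
    rewrite mulr_sumr; over.
  rewrite exchange_big; apply: eq_bigr => s _ /=.
  rewrite gapE mulmx_sumr linear_sum !mulr_sumr; apply: eq_bigr => i _.
  by rewrite linearZ -scalemxAl -scalemxAr !linearZ /=; ring.
apply: eq_bigr => s _; rewrite -mulrBr -mulrDr; congr (_ * _).
apply: lqr_cost_gap (K_feasible s) (Kstar_feasible s).
- by case: costQ_posdef.
- by case: costR_posdef.
- by case: cov0_posdef.
Qed.
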